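(* Let $D\ge d\ge 1$ be integers, let $T\subset\mathbb{R}^D$ be an open set and let $X:T\to\mathbb{R}^d$ be a random field with paths of class $C^1$. Let $u\in\mathbb{R}^d$. Assume that $X(t)$ has a density $p_{X(t)}$ for $t\in T$ and that there are a constant $C<\infty$ and a neighbourhood $V_u$ of $u$ such that $$\int_T p_{X(t)}(v)\,dt< C\quad\text{for all } v\in V_u .$$ Then, almost surely, $$\sigma_{D-d}\big(\{t\in T:\ X(t)=u,\ \Delta(t)=0\}\big)=0 .$$
   Context: $X'(t)$ is the derivative of $X$ at $t$ (a $d\times D$ matrix) and $\Delta(t):=\sqrt{\det(X'(t)X'(t)^\top)}$ is the generalized Jacobian. $\sigma_\ell$ is the $\ell$-dimensional Hausdorff measure on $\mathbb{R}^D$ (normalized to agree with Lebesgue measure on $\mathbb{R}^\ell$); $\sigma_0$ is the counting measure.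
   Formalization: The densities are additionally assumed jointly Borel measurable in (t,v) on T × R^d; without a jointly measurable version the bound on the integral over T depends on arbitrary choices of versions and, under the continuum hypothesis, the claim can fail. *)

(* Defs.v *)
From HB Require Import structures.
From mathcomp Require Import all_boot all_order all_algebra.
From mathcomp Require Import all_classical all_reals all_analysis.
From mathcomp Require Import measurable_realfun.

Set Implicit Arguments.
Unset Strict Implicit.
Unset Printing Implicit Defensive.

Import Order.TTheory GRing.Theory Num.Theory.
Import numFieldNormedType.Exports.

Local Open Scope classical_set_scope.
Local Open Scope ring_scope.

(* R^n is 'rV[R]_n, equipped with the Borel sigma-algebra of its topology. *)
Section matrix_borel.
Context {R : realType} (m n : nat).

HB.instance Definition _ :=
  @isMeasurable.Build (sigma_display (@open 'M[R]_(m, n))) 'M[R]_(m, n)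
    <<s @open 'M[R]_(m, n) >> (@sigma_algebra0 _ setT _)
    (@sigma_algebraC _ _) (@sigma_algebra_bigcup _ setT _).

End matrix_borel.

Section matrix_measurability.
Context {R : realType}.

Lemma open_measurable_mx m n (U : set 'M[R]_(m, n)) : open U -> measurable U.
Proof. by move=> oU; exact: sub_sigma_algebra. Qed.

Lemma measurable_coord m n i j :
  measurable_fun setT (fun M : 'M[R]_(m, n) => M i j).
Proof.
apply: (measurability _ (RGenOpens.measurableE R)).
move=> _ [_ [a [b ->] <-]].
rewrite setTI; apply: open_measurable_mx.
apply: open_comp; last exact: interval_open.
by move=> M _; exact: coord_continuous.
Qed.

Lemma open_mx_bigcup m n (U : set 'M[R]_(m, n)) : open U ->
  U = \bigcup_(z : 'M[rat]_(m, n) * nat)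
    (if `[< ball (map_mx ratr z.1 : 'M[R]_(m, n)) z.2.+1%:R^-1 `<=` U >]
     then ball (map_mx ratr z.1 : 'M[R]_(m, n)) z.2.+1%:R^-1 else set0).
Proof.
move=> oU; rewrite eqEsubset; split=> [x Ux|x [z _]]; last first.
  by case: ifPn => // /asboolP; apply.
have [e /= e0 exU] : exists2 e : R, 0 < e & ball x e `<=` U.
  by move: (open_nbhs_nbhs (conj oU Ux)) => /nbhs_ballP[e e0 ?]; exists e.
have [k ke] : exists k : nat, k.+1%:R^-1 < e / 2.
  have e20 : 0 < e / 2 by rewrite divr_gt0.
  by have [k _ kP] := near_infty_natSinv_lt (PosNum e20); exists k;
    exact: (kP k (leqnn _)).
have k0 : 0 < k.+1%:R^-1 :> R by rewrite invr_gt0 ltr0n.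
have /choice[q qP] : forall ij : 'I_m * 'I_n, exists r : rat,
    ball (ratr r : R) k.+1%:R^-1 (x ij.1 ij.2).
  move=> ij; have [|b [+ [r _ rE]]] := @dense_rat R (ball (x ij.1 ij.2) k.+1%:R^-1) _
    (ball_open (x ij.1 ij.2 : R^o) k.+1%:R^-1).
  - by exists (x ij.1 ij.2); exact: ballxx.
  - rewrite -rE => rb; by exists r; exact: ball_sym.
have xq : ball (map_mx ratr (\matrix_(i, j) q (i, j)) : 'M[R]_(m, n))
    k.+1%:R^-1 x.
  by split=> // i j; rewrite !mxE; exact: (qP (i, j)).
exists (\matrix_(i, j) q (i, j), k) => //=; rewrite ifT//.
apply/asboolP => y qy; apply: exU; rewrite (splitr e).
apply: ball_triangle (le_ball (ltW ke) qy).
by apply: (le_ball (ltW ke)); exact: ball_sym.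
Qed.

Lemma measurable_fun_mx d (T : measurableType d) m n (f : T -> 'M[R]_(m, n)) :
  (forall i j, measurable_fun setT (fun t => f t i j)) ->
  measurable_fun setT f.
Proof.
move=> mf; apply: (@measurability _ _ _ _ _ _ (@open 'M[R]_(m, n)) erefl).
move=> _ [U oU <-]; rewrite setTI (open_mx_bigcup oU) preimage_bigcup.
apply: countable_bigcupT_measurable; first exact: countableP.
move=> [q k] /=; case: ifPn => _; last by rewrite preimage_set0.
rewrite [X in measurable X](_ : _ = \bigcap_(ij : 'I_m * 'I_n)
    ((fun t => f t ij.1 ij.2) @^-1`
      ball (ratr (q ij.1 ij.2) : R) k.+1%:R^-1)).
  apply: fin_bigcap_measurable => [|ij _]; first exact: finite_finset.
  rewrite -[X in measurable X]setTI.
  by apply: mf => //; exact: measurable_ball.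
rewrite eqEsubset; split=> [t [_ /= b] ij _ /=|t /= b].
  by have := b ij.1 ij.2; rewrite mxE.
split; first by rewrite invr_gt0 ltr0n.
by move=> i j; rewrite mxE; exact: (b (i, j)).
Qed.

End matrix_measurability.

Section lebesgue_rV.
Context {R : realType}.
Local Open Scope ereal_scope.

Definition row_cons n (z : measurableTypeR R * 'rV[R]_n) : 'rV[R]_n.+1 :=
  row_mx (z.1%:M : 'rV[R]_1) z.2.

(* Iterated product measure; R^0 is a point of mass 1. *)
Fixpoint lebesgue_rV (n : nat) : set 'rV[R]_n -> \bar R :=
  match n with
  | 0 => \d_(0%R : 'rV[R]_0)
  | n'.+1 => pushforward (@lebesgue_measure R \x lebesgue_rV (n := n'))
                         (@row_cons n')
  end.

Lemma measurable_row_cons n : measurable_fun setT (@row_cons n).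
Proof.
apply: measurable_fun_mx => i j; rewrite ord1.
rewrite (_ : (fun t => _) = fun t : R * 'rV[R]_n =>
    match fintype.split (j : 'I_(1 + n)) with
    | inl _ => t.1 | inr k => t.2 ord0 k end).
  case: fintype.split => k; first exact: measurable_fst.
  exact: (measurableT_comp (measurable_coord _ _) measurable_snd).
apply/funext => t; rewrite /row_cons mxE; case: fintype.split => k //.
by rewrite !ord1 mxE mulr1n.
Qed.

HB.instance Definition _ n := isMeasurableFun.Build _ _ _ _ (@row_cons n)
  (@measurable_row_cons n).

Lemma sigma_finite_pushforward_row_cons n
    (mu : {sigma_finite_measure set 'rV[R]_n -> \bar R}) :
  sigma_finite setT (pushforward (@lebesgue_measure R \x mu) (@row_cons n)).
Proof.
have /sigma_finiteP[F [TF ndF Foo]] := sigma_finiteT (@lebesgue_measure R).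
have /sigma_finiteP[G [TG ndG Goo]] := sigma_finiteT mu.
pose g (v : 'rV[R]_n.+1) : R * 'rV[R]_n :=
  (v ord0 ord0, @rsubmx _ 1 1 n v).
have gK : cancel (@row_cons n) g.
  move=> [x v]; rewrite /g /row_cons/= row_mxKr; congr pair.
  by rewrite mxE; case: splitP => // k _; rewrite !ord1 mxE mulr1n.
have mg : measurable_fun setT g.
  apply/measurable_fun_pairP; split; first exact: measurable_coord.
  apply: measurable_fun_mx => i j.
  rewrite (_ : (fun t => _) = fun t : 'rV[R]_(1 + n) => t i (rshift 1 j)).
    exact: measurable_coord.
  by apply/funext => t /=; rewrite mxE.
exists (fun k => g @^-1` (F k `*` G k)).
  rewrite -preimage_bigcup (_ : \bigcup_i _ = setT) ?preimage_setT//.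
  rewrite -setXTT TF TG predeqE => -[x y]; split.
    by move=> [n' _ []/= ? ?]; split; exists n'.
  move=> [/= [n' _ Fnx] [k _ Gky]]; exists (maxn n' k) => //; split.
  - by move: x Fnx; exact/subsetPset/ndF/leq_maxl.
  - by move: y Gky; exact/subsetPset/ndG/leq_maxr.
move=> k; have [mF Foo'] := Foo k; have [mG Goo'] := Goo k.
have mFG : measurable (F k `*` G k) by exact: measurableX.
split; first by rewrite -[X in measurable X]setTI; exact: mg.
rewrite /pushforward -comp_preimage (_ : g \o _ = id); last first.
  by apply/funext => z; exact: gK.
by rewrite preimage_id product_measure1E// lte_mul_pinfty// ge0_fin_numE.
Qed.

Section row_cons_measure.
Variables (n : nat) (mu : {sigma_finite_measure set 'rV[R]_n -> \bar R}).

Definition row_cons_measure : set 'rV[R]_n.+1 -> \bar R :=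
  pushforward (@lebesgue_measure R \x mu) (@row_cons n).

Let row_cons_measure0 : row_cons_measure set0 = 0.
Proof. exact: measure0. Qed.

Let row_cons_measure_ge0 A : 0 <= row_cons_measure A.
Proof. exact: measure_ge0. Qed.

Let row_cons_measure_sigma_additive : semi_sigma_additive row_cons_measure.
Proof. exact: measure_semi_sigma_additive. Qed.

HB.instance Definition _ := isMeasure.Build _ _ _ row_cons_measure
  row_cons_measure0 row_cons_measure_ge0 row_cons_measure_sigma_additive.

HB.instance Definition _ := Measure_isSigmaFinite.Build _ _ _ row_cons_measure
  (sigma_finite_pushforward_row_cons mu).

End row_cons_measure.

Lemma lebesgue_rV_sigma_finite_measure n :
  exists mu : {sigma_finite_measure set 'rV[R]_n -> \bar R},
    (mu : set _ -> \bar R) = @lebesgue_rV n.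
Proof.
elim: n => [|n [mu muE]].
  by exists \d_(0%R : 'rV[R]_0).
by exists (row_cons_measure mu); rewrite /= -muE.
Qed.

Section lebesgue_rV_measure.
Variable n : nat.

Let lebesgue_rV0 : @lebesgue_rV n set0 = 0.
Proof.
by have [mu <-] := lebesgue_rV_sigma_finite_measure n; exact: measure0.
Qed.

Let lebesgue_rV_ge0 A : 0 <= @lebesgue_rV n A.
Proof.
by have [mu <-] := lebesgue_rV_sigma_finite_measure n; exact: measure_ge0.
Qed.

Let lebesgue_rV_sigma_additive : semi_sigma_additive (@lebesgue_rV n).
Proof.
have [mu <-] := lebesgue_rV_sigma_finite_measure n.
exact: measure_semi_sigma_additive.
Qed.

HB.instance Definition _ := isMeasure.Build _ _ _ (@lebesgue_rV n)
  lebesgue_rV0 lebesgue_rV_ge0 lebesgue_rV_sigma_additive.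

Let lebesgue_rV_sigma_finite : sigma_finite setT (@lebesgue_rV n).
Proof.
by have [mu <-] := lebesgue_rV_sigma_finite_measure n; exact: sigma_finiteT.
Qed.

HB.instance Definition _ := Measure_isSigmaFinite.Build _ _ _ (@lebesgue_rV n)
  lebesgue_rV_sigma_finite.

End lebesgue_rV_measure.

End lebesgue_rV.

Arguments lebesgue_rV R n : clear implicits.

Section hausdorff.
Context {R : realType} {n : nat}.
Implicit Types (x y : 'rV[R]_n) (A : set 'rV[R]_n) (l : nat).
Local Open Scope ereal_scope.

(* The library norm on 'rV[R]_n is the sup norm. *)
Definition euclidean_norm x : R := Num.sqrt (\sum_i (x ord0 i ^+ 2)%R)%R.

Definition diameter A : \bar R :=
  ereal_sup [set (euclidean_norm (x - y)%R)%:E | x in A & y in A].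

(* Volume of the Euclidean unit ball of R^l, by the recursion
   w_(l+2) = 2 pi / (l+2) w_l. *)
Fixpoint unit_ball_volume l : R :=
  match l with
  | 0 => 1
  | 1 => 2
  | l'.+2 => 2 * pi / l'.+2%:R * unit_ball_volume l'
  end%R.

(* Since x ^+ 0 = 1, every nonempty set has gauge 1 when l = 0, so that
   hausdorff_measure 0 is the counting measure. *)
Definition hausdorff_gauge l A : \bar R :=
  if `[< A = set0 >] then 0
  else (unit_ball_volume l)%:E * (2^-1%:E * diameter A) ^+ l.

Definition hausdorff_premeasure l (delta : R) A : \bar R :=
  ereal_inf [set \sum_(0 <= k <oo) hausdorff_gauge l (F k) | F in
    [set F : nat -> set 'rV[R]_n | A `<=` \bigcup_k F k /\
                                   forall k, diameter (F k) <= delta%:E]].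

Definition hausdorff_measure l A : \bar R :=
  ereal_sup [set hausdorff_premeasure l delta A | delta in
    [set delta : R | (0 < delta)%R]].

End hausdorff.

Section random_field.
Context {R : realType} {D d : nat}.

(* The library Jacobian acts on row vectors on the right; its transpose is
   the usual d x D matrix of partial derivatives. *)
Definition derivative_mx (f : 'rV[R]_D -> 'rV[R]_d) (t : 'rV[R]_D) :
  'M[R]_(d, D) := (jacobian f t)^T.

Definition generalized_jacobian (f : 'rV[R]_D -> 'rV[R]_d) (t : 'rV[R]_D) : R :=
  Num.sqrt (\det (derivative_mx f t *m (derivative_mx f t)^T)).

(* T is meant to be open: the values of f outside T are then irrelevant. *)
Definition class_C1 (T : set 'rV[R]_D) (f : 'rV[R]_D -> 'rV[R]_d) : Prop :=
  forall t, T t ->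
    differentiable f t /\ {for t, continuous (derivative_mx f)}.

Context {dO : measure_display} {Omega : measurableType dO}.
Variable P : probability Omega R.

Definition has_density (Y : Omega -> 'rV[R]_d) (p : 'rV[R]_d -> R) : Prop :=
  [/\ measurable_fun setT p, (forall v, 0 <= p v) &
    forall B : set 'rV[R]_d, measurable B ->
      P (Y @^-1` B) = (\int[lebesgue_rV R d]_(v in B) (p v)%:E)%E].

End random_field.

(* Main.v *)
(** Let [mu_w(r)] be the volume of the set of [t] in [T] with [|X(t, w) - u| < r].
    Integrating the density bound gives [E (mu_w(r)) <= C (2 r)^d] for small
    [r], so by Fatou's lemma [liminf mu_w(r) / r^d] is almost surely finite.
    On the other hand, at a critical point [t] of the level [u] the kernel of
    [X'(t)] has dimension at least [k = D - d + 1], and [X] stays [L rho]-close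
    to [u] on about [N^k] disjoint cubes of side [rho] centred at points of
    [t + ker X'(t)] at distance at most [k N rho] from [t].  If [m] points of a
    compact part of the critical set are separated by [(2 k N + 1) rho], then
    [m N^k rho^D <= mu_w(L rho)], which is [O(rho^d)] along a sequence
    [rho -> 0].  For a maximal such family, the balls of radius
    [(2 k N + 1) rho] around the points cover this part of the critical set,
    with a [(D - d)]-dimensional premeasure [O(m (N rho)^(D - d)) = O(1 / N)]. *)

Require Import Defs.
From HB Require Import structures.
From mathcomp Require Import all_boot all_order all_algebra.
From mathcomp Require Import all_classical all_reals all_analysis.
From mathcomp Require Import measurable_realfun.
From mathcomp Require Import zify ring lra.

Set Implicit Arguments.
Unset Strict Implicit.
Unset Printing Implicit Defensive.

Import Order.TTheory GRing.Theory Num.Theory.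
Import numFieldNormedType.Exports.

Local Open Scope classical_set_scope.
Local Open Scope ring_scope.

(** * Linear algebra *)

Section linear_algebra.
Context {R : realType}.

Lemma le_coord_mx_norm m n (A : 'M[R]_(m, n)) i j : `|A i j| <= `|A|.
Proof.
rewrite [leRHS]/Num.norm /= mx_normrE; apply/bigmax_geP; right => /=.
by exists (i, j).
Qed.

Lemma mulmx_tr_row_eq0 n (v : 'rV[R]_n) : (v *m v^T) 0 0 <= 0 -> v = 0.
Proof.
rewrite mxE (eq_bigr (fun j => v 0 j ^+ 2)); last by move=> j _; rewrite mxE expr2.
move=> le0; have /eqP : \sum_j v 0 j ^+ 2 = 0.
  by apply/eqP; rewrite eq_le le0/= sumr_ge0// => j _; rewrite sqr_ge0.
rewrite psumr_eq0; last by move=> j _; rewrite sqr_ge0.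
move=> /allP v0; apply/rowP => j; rewrite mxE.
by apply/eqP; rewrite -sqrf_eq0; apply: v0; rewrite mem_index_enum.
Qed.

(* The sign of [\det (A *m A^T)] is obtained by continuity along the segment
   joining [1%:M] to [A *m A^T], whose matrices are positive definite except
   possibly at the end. *)
Lemma det_gram_le0 m n (A : 'M[R]_(m, n)) :
  \det (A *m A^T) <= 0 -> exists2 v : 'rV_m, v != 0 & v *m A = 0.
Proof.
move=> G0; set G := A *m A^T in G0.
pose p : {poly R} := \det ('X *: map_mx polyC G + (1 - 'X)%:M).
have pE x : p.[x] = \det (x *: G + (1 - x)%:M).
  rewrite -[LHS]/(horner_eval x p) /p -det_map_mx; congr (\det _).
  apply/matrixP => i j; rewrite !mxE /= /horner_eval !hornerE.
  by rewrite hornerMn !hornerE.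
have vGv (v : 'rV_m) : (v *m G *m v^T) 0 0 = ((v *m A) *m (v *m A)^T) 0 0.
  by rewrite /G trmx_mul !mulmxA.
(* The intermediate value theorem is applied to [- p] because [p.[0] = 1] and [p.[1] = \det G <=
   0]. *)
have [|x] := @poly_ivt R (- p) 0 1 ler01.
  rewrite !hornerN oppr_le0 oppr_ge0 !pE scale0r add0r subr0 det1 ler01/=.
  by rewrite scale1r subrr raddf0 addr0.
move=> /andP[x0 x1].
rewrite rootN /root pE => /det0P[v v0].
rewrite mulmxDr mul_mx_scalar -scalemxAr => /(congr1 (mulmx^~ v^T)).
rewrite mul0mx mulmxDl -!scalemxAl => /matrixP/(_ 0 0).
rewrite [LHS]mxE [X in X + _]mxE [X in _ + X]mxE [RHS]mxE vGv => E.
have sq_ge0 k (w : 'rV[R]_k) : 0 <= (w *m w^T) 0 0.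
  by rewrite mxE sumr_ge0// => j _; rewrite mxE -expr2 sqr_ge0.
(* [E] says [x |vA|^2 + (1 - x) |v|^2 = 0] with Euclidean norms. For [x < 1] this forces [v = 0], so
   the root is [x = 1] and [vA = 0]. *)
have [xlt1|xge1] := ltP x 1.
  case/eqP: v0; apply: mulmx_tr_row_eq0.
  rewrite -(pmulr_rle0 _ (_ : 0 < 1 - x)) ?subr_gt0//.
  have : 0 <= x * (v *m A *m (v *m A)^T) 0 0 by rewrite mulr_ge0.
  move=> h; rewrite -E lerDr//.
have x1' : x = 1 by apply/eqP; rewrite eq_le x1.
exists v => //; apply: mulmx_tr_row_eq0.
by rewrite x1' mul1r subrr mul0r addr0 in E; rewrite E.
Qed.

(** Induction on [k]: take [v] in [W] of sup norm 1, attained at coordinate [j], and cut [W] by the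
    hyperplane where coordinate [j] vanishes, losing at most one dimension. In [w i + a v] with
    [a < N], coordinate [j] separates different [a], and the induction hypothesis separates
    different [i]. *)
Lemma sep_lattice_in_subspace m n k N (W : 'M[R]_(m, n)) : (k <= \rank W)%N ->
  exists (I : finType) (w : I -> 'rV[R]_n), [/\ #|I| = (N ^ k)%N,
    (forall i, (w i <= W)%MS), (forall i, `|w i| <= (k * N)%:R) &
    forall i j, i != j -> 1 <= `|w i - w j|].
Proof.
elim: k m W => [|k IH] m W rW.
  exists unit, (fun=> 0); split=> [|_|_|[] []//].
  - by rewrite card_unit expn0.
  - exact: sub0mx.
  - by rewrite normr0.
have [v [v1 vW]] : exists v : 'rV[R]_n, `|v| = 1 /\ (v <= W)%MS.
  have /rowV0Pn[v vW v0] : W != 0.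
    by rewrite -mxrank_eq0 -lt0n; exact: leq_trans rW.
  exists (`|v|^-1 *: v); split; last exact: scalemx_sub.
  by rewrite normrZ ger0_norm ?invr_ge0// mulVf// normr_eq0.
have [[i0 j]] : exists ij : 'I_1 * 'I_n, `|v| = `|v ij.1 ij.2|.
  by apply: mx_norm_neq0; rewrite -[mx_norm v]/(`|v|) v1 oner_neq0.
rewrite ord1 v1 /= => vj.
pose W' := (W :&: kermx (delta_mx j (0 : 'I_1)))%MS.
have W'j (u : 'rV_n) : (u <= W')%MS -> u 0 j = 0.
  move=> uW'; have /sub_kermxP/matrixP/(_ 0 0) :
      (u <= kermx (delta_mx j (0 : 'I_1)))%MS.
    exact: submx_trans uW' (capmxSr _ _).
  rewrite !mxE (bigD1 j)//= big1 ?addr0 ?mxE ?eqxx ?mulr1// => l lj.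
  by rewrite mxE (negPf lj) mulr0.
have [|I [w [cI wW' wN wsep]]] := IH _ W'.
  have := mxrank_sum_cap W (kermx (delta_mx j (0 : 'I_1))).
  rewrite mxrank_ker mxrank_delta => h.
  have := rank_leq_col (W + kermx (delta_mx j (0 : 'I_1)))%MS.
  have n0 : (0 < n)%N by case: (n) (j) => // -[].
  move: h rW; rewrite -/W'; move: (\rank _) (\rank W) (\rank W') => a b c.
  by move=> h rW h2; rewrite -(leq_add2l a) h; move: rW h2; clear -n0; lia.
exists (I * 'I_N)%type, (fun ia : I * 'I_N => w ia.1 + (ia.2 : nat)%:R *: v); split.
- by rewrite card_prod cI card_ord expnS mulnC.
- move=> ia; apply: addmx_sub; last exact: scalemx_sub.
  exact: submx_trans (wW' _) (capmxSl _ _).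
- move=> ia; apply: le_trans (ler_normD _ _) _.
  rewrite mulSn addnC natrD lerD// normrZ v1 mulr1 normr_nat ler_nat.
  exact/ltnW/ltn_ord.
- move=> [i a] [i' b] /= ne.
  have [ab|ab] := eqVneq a b.
    rewrite ab opprD addrACA subrr addr0; apply: wsep.
    by apply: contra_neq ne => ->; rewrite ab.
  apply: le_trans (le_coord_mx_norm _ 0 j).
  rewrite !mxE (W'j _ (wW' i)) (W'j _ (wW' i')) !add0r -mulrBl normrM -vj mulr1.
  have : (a : nat) != b by [].
  rewrite neq_ltn => /orP[] h; [rewrite distrC|];
    rewrite -natrB 1?ltnW// normr_nat ler1n subn_gt0//.
Qed.

End linear_algebra.

(** * Volumes of balls *)

Section lebesgue_rV_balls.
Context {R : realType}.

Lemma measurable_ball_rV n (x : 'rV[R]_n) r : measurable (ball x r).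
Proof. apply: open_measurable_mx; exact: ball_open. Qed.

(** Balls are for the sup norm, hence cubes of side [2 * r]; the induction splits off the first
    coordinate. *)
Lemma lebesgue_rV_ball n (x : 'rV[R]_n) r : 0 < r ->
  lebesgue_rV R n (ball x r) = ((2 * r) ^+ n)%:E.
Proof.
move=> r0; elim: n x => [|n IH] x.
  rewrite expr0 /= diracE mem_set//; split=> // i j; by case: j.
rewrite -[LHS]/(pushforward (@lebesgue_measure R \x lebesgue_rV R n)%E
  (@row_cons R n) (ball x r)).
rewrite /pushforward.
have -> : @row_cons R n @^-1` ball x r =
    ball (x 0 0) r `*` ball (\row_j x 0 (lift 0 j)) r.
  apply/seteqP; split => [[a v]|[a v]] /=.
    move=> [_ b]; split.
      have := b 0 0; rewrite /row_cons mxE; case: splitP => // k _ /=.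
      by rewrite !ord1 mxE mulr1n.
    split=> // i j; rewrite mxE ord1; have := b 0 (lift 0 j).
    rewrite /row_cons mxE; case: splitP => /= k; first by rewrite ord1.
    by rewrite /bump/= => -[jk]; rewrite (_ : j = k)//; exact: val_inj.
  move=> [ba [_ bv]]; split=> // i j; rewrite !ord1 /row_cons mxE.
  case: splitP => /= k jk.
    rewrite ord1 mxE mulr1n (_ : j = 0)//; apply: val_inj.
    by rewrite ord1 in jk.
  have := bv 0 k; rewrite mxE (_ : j = lift 0 k)//.
  by apply: val_inj => /=; rewrite jk.
rewrite product_measure1E; [|exact: measurable_ball|exact: measurable_ball_rV].
rewrite -[LHS]/(lebesgue_measure (ball (x 0 0)%R r) *
  lebesgue_rV R n (ball (\row_j x 0 (lift 0 j))%R r))%E.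
by rewrite lebesgue_measure_ball ?ltW// IH -EFinM exprS mulr_natl.
Qed.

(** The balls of radius [rho / 2] are pairwise disjoint, and each has volume [rho ^+ n]. *)
Lemma sep_balls_volume n (I : finType) (c : I -> 'rV[R]_n) (rho : R)
    (G : set 'rV[R]_n) : 0 < rho -> measurable G ->
  (forall i j, i != j -> rho <= `|c i - c j|) ->
  (forall i, ball (c i) (rho / 2) `<=` G) ->
  ((#|I|%:R * rho ^+ n)%:E <= lebesgue_rV R n G)%E.
Proof.
move=> rho0 mG sep cG.
have tI : trivIset [set` predT] (fun i => ball (c i) (rho / 2)).
  apply/trivIsetP => i j _ _ ij; rewrite -subset0 => y [].
  rewrite -!ball_normE /ball_/= => yi yj.
  have := sep i j ij; rewrite leNgt; apply/negP; rewrite negbK.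
  rewrite (_ : c i - c j = (c i - y) + (y - c j)); last by rewrite addrA subrK.
  apply: le_lt_trans (ler_normD _ _) _.
  by rewrite (splitr rho) ltrD// distrC.
have <- : (\sum_(i : I) lebesgue_rV R n (ball (c i) (rho / 2)) =
    (#|I|%:R * rho ^+ n)%:E)%E.
  rewrite (eq_bigr (fun=> (rho ^+ n)%:E)).
    by rewrite sumEFin sumr_const mulr_natl.
  by move=> i _; rewrite lebesgue_rV_ball ?divr_gt0// mulrC divfK// pnatr_eq0.
rewrite fsbig_seq ?index_enum_uniq// -measure_fin_bigcup//; last 2 first.
- exact: sub_trivIset tI.
- by move=> i _; exact: measurable_ball_rV.
apply: le_measure; rewrite ?inE//.
  by apply: fin_bigcup_measurable => // i _; exact: measurable_ball_rV.
by move=> y [i _]; exact: cG.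
Qed.

(** Links Euclidean diameters to sup-norm balls; the crude factor [n] instead of its square root
    suffices. *)
Lemma euclidean_norm_le n (x : 'rV[R]_n) : euclidean_norm x <= n%:R * `|x|.
Proof.
rewrite /euclidean_norm -[leRHS]ger0_norm ?mulr_ge0// -sqrtr_sqr ler_wsqrtr//.
apply: (@le_trans _ _ (\sum_(i < n) `|x| ^+ 2)).
  apply: ler_sum => i _; rewrite -[leLHS]real_normK ?num_real// lerXn2r ?nnegrE//.
  exact: le_coord_mx_norm.
rewrite sumr_const card_ord exprMn -[leLHS]mulr_natl.
apply: ler_wpM2r; first exact: sqr_ge0.
by rewrite -natrX ler_nat; case: (n) => // k; rewrite expnS leq_pmulr.
Qed.

End lebesgue_rV_balls.

(** * Uniform differentiability on compact sets *)

Section differentiability.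
Context {R : realType}.

Lemma norm_mulmx m n (h : 'rV[R]_m) (A : 'M[R]_(m, n)) :
  `|h *m A| <= m%:R * `|h| * `|A|.
Proof.
rewrite [leLHS]/Num.norm /= mx_normrE; apply: bigmax_le => [|[i j] _] /=.
  by rewrite !mulr_ge0.
rewrite mxE; apply: le_trans (ler_norm_sum _ _ _) _.
have -> : m%:R * `|h| * `|A| = \sum_(k < m) `|h| * `|A|.
  by rewrite sumr_const card_ord -mulrA mulr_natl.
apply: ler_sum => k _; by rewrite normrM ler_pM// le_coord_mx_norm.
Qed.

Lemma ball_trmx m n (A B : 'M[R]_(m, n)) e : ball A^T e B^T -> ball A e B.
Proof. by move=> [e0 AB]; split=> // i j; have := AB j i; rewrite !mxE. Qed.

Variables (D d : nat) (T : set 'rV[R]_D) (f : 'rV[R]_D -> 'rV[R]_d).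
Hypothesis fC1 : class_C1 T f.

Lemma class_C1_jacobian_near t (e : R) : T t -> 0 < e ->
  exists2 r, 0 < r & forall x, ball t r x -> `|jacobian f x - jacobian f t| < e.
Proof.
move=> /fC1[_ cf] e0.
have /nbhs_ballP[r r0 h] := cf _ (nbhsx_ballx (derivative_mx f t) _ e0).
exists r => // x /h; rewrite /derivative_mx => /ball_trmx.
by rewrite distrC -ball_normE.
Qed.

(** Prepares the mean value theorem, which is for real functions: hence a single coordinate along a
    line. *)
Lemma is_derive_line_coord x h s j : differentiable f (x + s *: h) ->
  is_derive (s : R) (1 : R) (fun s : R => f (x + s *: h) 0 j)
    ((h *m jacobian f (x + s *: h)) 0 j).
Proof.
move=> df; set y := x + s *: h.
have /derivable_mxP/(_ 0 j) dfy : derivable f y h by exact: diff_derivable.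
have E : (fun k : R => k^-1 *:
       (((fun s : R => f (x + s *: h) 0 j) \o shift s) (k *: 1) - f y 0 j))
   = (fun k : R => k^-1 *: (((fun z => f z 0 j) \o shift y) (k *: h) - f y 0 j)).
  apply/funext => k /=; congr (_ *: (f _ 0 j - _)).
  by rewrite /y scalerDl addrCA /= [k *: 1]mulr1.
split; first by rewrite /derivable E.
rewrite /derive E -[LHS]/('D_h (fun z => f z 0 j) y).
have := derive_mx (diff_derivable (v := h) df).
rewrite deriveEjacobian// => ->; by rewrite mxE.
Qed.

(** Mean value theorem for each coordinate on the segment from [x] to [x + h], which stays in a
    convex ball where the Jacobian is nearly constant. *)
Lemma strict_diff t (e : R) : open T -> T t -> 0 < e ->
  exists2 r : R, 0 < r & forall x h, ball t r x -> ball t r (x + h) ->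
    `|f (x + h) - f x - h *m jacobian f x| <= e * `|h|.
Proof.
(* The 2 pays for comparing two Jacobians through the one at [t], the dimension for [norm_mulmx];
   the successor keeps the denominator nonzero. *)
move=> oT Tt e0; pose e' := e / (2 * D.+1%:R).
have e'0 : 0 < e' by rewrite divr_gt0.
have [r1 r10 Jr] := class_C1_jacobian_near Tt e'0.
have /nbhs_ballP[r2 /= r20 rT] : nbhs t T by exact: open_nbhs_nbhs.
exists (Num.min r1 r2) => [|x h tx txh]; first by rewrite lt_min r10.
have seg s : 0 <= s <= 1 -> ball t (Num.min r1 r2) (x + s *: h).
  move=> /andP[s0 s1]; move: tx txh; rewrite -!ball_normE /= => tx txh.
  have -> : t - (x + s *: h) = (1 - s) *: (t - x) + s *: (t - (x + h)).
    by apply/rowP => k; rewrite !mxE; ring.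
  apply: le_lt_trans (ler_normD _ _) _.
  rewrite !normrZ (ger0_norm s0) ger0_norm ?subr_ge0//.
  move: tx txh; move: `|t - x| `|t - (x + h)| (Num.min r1 r2) => a b c ac bc.
  have [->|s0'] := eqVneq s 0; first by rewrite subr0 mul0r addr0 mul1r.
  have s0'' : 0 < s by rewrite lt_def s0'.
  by nra.
have dfs s : 0 <= s <= 1 -> differentiable f (x + s *: h).
  move=> /seg sh; apply: (fC1 _).1; apply: rT; apply: le_ball sh.
  by rewrite ge_min lexx orbT.
have Js s : 0 <= s <= 1 -> `|jacobian f (x + s *: h) - jacobian f x| <= 2 * e'.
  move=> /seg sh.
  apply: le_trans (ler_distD (jacobian f t) _ _) _.
  rewrite mulr_natl mulr2n lerD ?ltW//.
    by apply: Jr; apply: le_ball sh; rewrite ge_min lexx.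
  rewrite distrC; by apply: Jr; apply: le_ball tx; rewrite ge_min lexx.
rewrite [leLHS]/Num.norm /= mx_normrE; apply: bigmax_le => [|[i j] _] /=.
  by rewrite mulr_ge0// ltW.
rewrite ord1.
have [||c c01] := @MVT_segment _ (fun s : R => f (x + s *: h) 0 j)
    (fun s => (h *m jacobian f (x + s *: h)) 0 j) 0 1 ler01.
- move=> s; rewrite in_itv/= => /andP[s0 s1].
  by apply: is_derive_line_coord; apply: dfs; rewrite !ltW.
- apply: derivable_within_continuous => s; rewrite in_itv/= => s01.
  by have [] := is_derive_line_coord j (dfs _ s01).
rewrite scale1r scale0r addr0 subr0 mulr1 !mxE => ->.
rewrite in_itv/= in c01.
apply: (@le_trans _ _ `|h *m (jacobian f (x + c *: h) - jacobian f x)|).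
  apply: le_trans (le_coord_mx_norm _ 0 j).
  by rewrite mulmxBr !mxE.
apply: le_trans (norm_mulmx _ _) _.
apply: (@le_trans _ _ (D.+1%:R * `|h| * (2 * e'))).
  by rewrite ler_pM// ?mulr_ge0//; [rewrite ler_wpM2r// ler_nat|exact: Js].
rewrite /e' le_eqVlt; apply/orP; left; apply/eqP; field.
by rewrite nat1r pnatr_eq0.
Qed.

(** The radius from [strict_diff] serves all points near [t]; compactness in near-covering form
    makes it uniform on [K]. *)
Lemma unif_diff K (e : R) : open T -> compact K -> K `<=` T -> 0 < e ->
  exists2 r : R, 0 < r & forall x h, K x -> `|h| < r ->
    `|f (x + h) - f x - h *m jacobian f x| <= e * `|h|.
Proof.
move=> oT /compact_near_coveringP cK KT e0.
have := cK _ (0 : R)^'+ (fun r x => forall h, `|h| < r ->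
    `|f (x + h) - f x - h *m jacobian f x| <= e * `|h|) _.
case=> [t Kt|r r0 /(_ (r / 2))].
  have [r r0 rh] := strict_diff oT (KT _ Kt) e0.
  (* Halving leaves room for both [x] and [x + h] in the ball of radius [r]. *)
  exists (ball t (r / 2), [set s | s < r / 2]) => /=.
    split; first exact: nbhsx_ballx (divr_gt0 r0 _).
    exact: nbhs_right_lt (divr_gt0 r0 _).
  move=> [x s] /= [tx sr] h hs; apply: rh.
    by apply: le_ball tx; rewrite ler_pdivrMr// ler_pMr// ler1n.
  rewrite (splitr r); apply: ball_triangle tx _.
  by rewrite -ball_normE /= opprD addNKr normrN (lt_trans hs).
rewrite /= sub0r normrN ger0_norm ?divr_ge0 ?ltW//.
have r20 : 0 < r / 2 by rewrite divr_gt0.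
rewrite ltr_pdivrMr// ltr_pMr// ltr1n => /(_ isT r20) h.
by exists (r / 2) => // x k /h; exact.
Qed.

Lemma jacobian_bound K : compact K -> K `<=` T ->
  exists2 L : R, 0 < L & forall x, K x -> `|jacobian f x| <= L.
Proof.
move=> /compact_near_coveringP cK KT.
have := cK _ (+oo : set_system R) (fun L x => `|jacobian f x| <= L) _.
case=> [t Kt|L [_ /(_ (Num.max 1 (L + 1)))]].
  have [r r0 rh] := class_C1_jacobian_near (KT _ Kt) ltr01.
  exists (ball t r, [set s | `|jacobian f t| + 1 <= s]) => /=.
    split; first exact: nbhsx_ballx.
    exact: nbhs_pinfty_ge.
  move=> [x s] /= [/rh/ltW tx]; apply: le_trans.
  rewrite -[leLHS](subrK `|jacobian f t|) addrC lerD2l.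
  exact: le_trans (lerB_dist _ _) tx.
rewrite lt_max ltrDl ltr01 orbT => /(_ isT) h.
by exists (Num.max 1 (L + 1)); rewrite ?lt_max ?ltr01.
Qed.

End differentiability.

(** * Sets of Hausdorff measure zero *)

Section hausdorff_null.
Context {R : realType} {n : nat}.
Implicit Types A : set 'rV[R]_n.
Local Open Scope ereal_scope.

(** The diameter of the empty set is [-oo], a supremum over nothing. *)
Lemma diameter_ge0 A : A !=set0 -> 0 <= diameter A.
Proof.
move=> [x Ax]; apply: ereal_sup_ubound; exists x => //; exists x => //.
rewrite subrr /euclidean_norm big1 ?sqrtr0// => i _.
by rewrite mxE expr0n.
Qed.

Lemma unit_ball_volume_ge0 l : (0 <= unit_ball_volume l :> R)%R.
Proof.
elim/ltn_ind: l => -[|[|l]] IH //=.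
by rewrite !mulr_ge0 ?pi_ge0 ?IH.
Qed.

Lemma hausdorff_gauge_ge0 l A : 0 <= hausdorff_gauge l A.
Proof.
rewrite /hausdorff_gauge; case: asboolP => // /eqP/set0P A0.
rewrite mule_ge0 ?lee_fin ?unit_ball_volume_ge0// expe_ge0// mule_ge0//.
exact: diameter_ge0.
Qed.

(** Premeasures are nonnegative, so their supremum vanishes exactly when each of them does, that is,
    when covers have arbitrarily small gauge sums. *)
Lemma hausdorff_measure_eq0P l A : hausdorff_measure l A = 0 <->
  forall delta e : R, (0 < delta)%R -> (0 < e)%R -> exists F : nat -> set 'rV[R]_n,
    [/\ A `<=` \bigcup_k F k, forall k, diameter (F k) <= delta%:E &
        \sum_(0 <= k <oo) hausdorff_gauge l (F k) <= e%:E].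
Proof.
have pre_ge0 delta : 0 <= hausdorff_premeasure l delta A.
  apply: le_ereal_inf_tmp => _ [F _ <-].
  by apply: nneseries_ge0 => k _ _; exact: hausdorff_gauge_ge0.
split=> [H0 delta e delta0 e0|H].
  have : hausdorff_premeasure l delta A < e%:E.
    apply: le_lt_trans (_ : _ <= 0) _; last by rewrite lte_fin.
    by rewrite -H0; apply: ereal_sup_ubound; exists delta.
  move=> /ereal_inf_lt[_ [F [AF dF] <-] Fe].
  by exists F; split => //; exact: ltW.
apply/eqP; rewrite eq_le; apply/andP; split.
  apply: ge_ereal_sup => _ [delta /= delta0 <-].
  apply/lee_addgt0Pr => e e0; rewrite add0e.
  have [F [AF dF Fe]] := H _ _ delta0 e0.
  by apply: le_trans Fe; apply: ereal_inf_lbound; exists F.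
apply: le_trans (pre_ge0 1%R) _.
by apply: ereal_sup_ubound; exists 1%R => //=.
Qed.

(** The cover of [B j] is given the budget [e / 2 ^ j.+1], and all covers are merged along a
    bijection of [nat] with [nat * nat]. *)
Lemma hausdorff_measure_bigcup_eq0 l A (B : nat -> set 'rV[R]_n) :
  A `<=` \bigcup_j B j -> (forall j, hausdorff_measure l (B j) = 0) ->
  hausdorff_measure l A = 0.
Proof.
move=> AB B0; apply/hausdorff_measure_eq0P => delta e delta0 e0.
have /choice[F HF] j : exists F : nat -> set 'rV[R]_n,
    [/\ B j `<=` \bigcup_k F k, forall k, diameter (F k) <= delta%:E &
        \sum_(0 <= k <oo) hausdorff_gauge l (F k) <= (e / (2 ^ j.+1)%:R)%:E].
  by move/hausdorff_measure_eq0P: (B0 j); apply => //; rewrite divr_gt0.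
have /card_set_bijP[g gbij] := card_esym card_nat2.
have g_ge0 i j : 0 <= hausdorff_gauge l (F i j) by exact: hausdorff_gauge_ge0.
exists (fun k => F (g k).1 (g k).2); split.
- move=> x /AB[j _ Bx]; have [/(_ _ Bx)[k _ Fx] _ _] := HF j.
  have [_ _ /(_ (j, k) I)[i _ gi]] := gbij.
  by exists i => //; rewrite gi.
- by move=> k; have [_ + _] := HF (g k).1; exact.
(* Unordered sums can be reindexed by [g] and then split into iterated sums. *)
rewrite nneseries_esumT//.
rewrite -(reindex_esum _ _ _ (fun ij => hausdorff_gauge l (F ij.1 ij.2)) gbij).
have -> : [set: nat * nat] = [set: nat] `*`` (fun=> [set: nat]).
  by apply/seteqP; split.
rewrite -(@esum_esum _ _ _ _ _ (fun i j => hausdorff_gauge l (F i j)))//.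
rewrite -nneseries_esumT; last by move=> i; apply: esum_ge0.
have := @epsilon_trick R (fun=> 0) e xpredT (fun=> lexx 0) (ltW e0).
rewrite [X in _ <= X + _]eseries0// add0e; apply: le_trans.
apply: lee_nneseries => [i _ _|i _]; first by apply: esum_ge0.
by rewrite add0e -nneseries_esumT//; have [] := HF i.
Qed.

Lemma diameter_ball A c (s : R) : A `<=` ball c s ->
  diameter A <= (n%:R * (s *+ 2))%:E.
Proof.
move=> As; apply: ge_ereal_sup => _ [x Ax [y Ay <-]]; rewrite lee_fin.
apply: le_trans (euclidean_norm_le _) _; rewrite ler_wpM2l//.
have := As _ Ay; have := As _ Ax; rewrite -!ball_normE /= => cx cy.
rewrite (_ : x - y = (x - c) + (c - y))%R; last by rewrite addrA subrK.
by apply: le_trans (ler_normD _ _) _; rewrite mulr2n lerD// ltW// distrC.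
Qed.

Lemma hausdorff_gauge_ball l A c (s : R) : (0 <= s)%R -> A `<=` ball c s ->
  hausdorff_gauge l A <= (unit_ball_volume l * (n%:R * s) ^+ l)%:E.
Proof.
move=> s0 As; rewrite /hausdorff_gauge; case: asboolP => [_|/eqP/set0P A0].
  by rewrite lee_fin mulr_ge0 ?unit_ball_volume_ge0// exprn_ge0// mulr_ge0.
have := diameter_ge0 A0; have := diameter_ball As.
case: (diameter A) => // r; rewrite !lee_fin => rs r0.
rewrite -EFinM -EFin_expe -EFinM lee_fin ler_wpM2l ?unit_ball_volume_ge0//.
rewrite lerXn2r ?nnegrE ?mulr_ge0// ler_pdivrMl//.
by apply: le_trans rs _; rewrite mulrnAr -mulr_natl.
Qed.

Lemma ball_cover_gauge_sum l A m (c : 'I_m -> 'rV[R]_n) (s delta : R) :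
  (0 < s)%R -> A `<=` \bigcup_i ball (c i) s -> (n%:R * (s *+ 2) <= delta)%R ->
  exists F : nat -> set 'rV[R]_n,
    [/\ A `<=` \bigcup_k F k, forall k, diameter (F k) <= delta%:E &
      \sum_(0 <= k <oo) hausdorff_gauge l (F k) <=
      (m%:R * (unit_ball_volume l * (n%:R * s) ^+ l))%:E].
Proof.
move=> s0 Ac sdelta.
(* The finite cover is padded with empty sets, of gauge 0 and diameter [-oo]. *)
pose F k := if insub k is Some i then ball (c i) s else set0.
exists F; split.
- by move=> x /Ac[i _ ix]; exists (i : nat) => //; rewrite /F valK.
- move=> k; rewrite /F; case: insub => [i|].
    by apply: le_trans (@diameter_ball _ (c i) s (fun _ h => h)) _; rewrite lee_fin.
  rewrite /diameter (_ : [set _ | _ in _ & _ in _] = set0) ?ereal_sup0 ?leNye//.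
  by apply/seteqP; split => // y [].
rewrite (nneseries_split 0 m); last by move=> k _; exact: hausdorff_gauge_ge0.
rewrite add0n eseries0 ?adde0; last first.
  move=> k mk _; rewrite /F insubF; last by rewrite ltnNge mk.
  by rewrite /hausdorff_gauge asboolT.
apply: (@le_trans _ _ (\sum_(0 <= k < m) (unit_ball_volume l * (n%:R * s) ^+ l)%:E)).
  apply: lee_sum => k _; rewrite /F; case: insub => [i|].
    by apply: (@hausdorff_gauge_ball _ _ (c i) s (ltW s0) (fun _ h => h)).
  rewrite /hausdorff_gauge asboolT// lee_fin.
  by rewrite mulr_ge0 ?unit_ball_volume_ge0// exprn_ge0// mulr_ge0// ltW.
by rewrite sumEFin big_const_nat iter_addr subn0 addr0 -[(_ *+ m)%R]mulr_natl.
Qed.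

End hausdorff_null.

(** * Critical points of a level of a deterministic map *)

Section critical_level_set.
Context {R : realType}.

(** The bound [b] provides a separated family of largest size; a point of [A] outside its balls
    could be added to it. *)
Lemma maximal_separated n (A : set 'rV[R]_n) (s : R) (b : nat) :
  (forall m (c : 'I_m -> 'rV[R]_n), (forall i, A (c i)) ->
    (forall i j, i != j -> s <= `|c i - c j|) -> (m <= b)%N) ->
  exists m (c : 'I_m -> 'rV[R]_n), [/\ (forall i, A (c i)),
    (forall i j, i != j -> s <= `|c i - c j|) &
    A `<=` \bigcup_i ball (c i) s].
Proof.
move=> bounded.
pose P m := `[< exists c : 'I_m -> 'rV[R]_n, (forall i, A (c i)) /\
  (forall i j, i != j -> s <= `|c i - c j|) >].
have exP : exists m, P m.
  by exists 0%N; apply/asboolP; exists (fun=> 0); split; case.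
have ubP m : P m -> (m <= b)%N.
  by move=> /asboolP[c [Ac sc]]; exact: bounded Ac sc.
case: (ex_maxnP exP ubP) => m /asboolP[c [Ac sc]] maxm.
exists m, c; split => // x Ax; apply: contrapT => nx.
have far i : s <= `|x - c i|.
  rewrite leNgt; apply/negP => xi; apply: nx; exists i => //.
  by rewrite -ball_normE /= distrC.
suff : P m.+1 by move=> /maxm; rewrite ltnn.
apply/asboolP; exists (fun i => if unlift ord0 i is Some j then c j else x).
split=> [i|i j]; first by case: unliftP.
case: unliftP => [i' ->|->]; case: unliftP => [j' ->|->] ij; rewrite ?eqxx// in ij *.
- by apply: sc; apply: contra_neq ij => ->.
- by rewrite distrC.
Qed.

Variables (D d : nat) (T : set 'rV[R]_D) (f : 'rV[R]_D -> 'rV[R]_d).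
Hypotheses (D_ged : (d <= D)%N) (T_open : open T) (fC1 : class_C1 T f).

(** [Num.sqrt] is 0 on negative numbers, so only [\det <= 0] is known, which is what [det_gram_le0]
    takes. It gives rank below [d], and rank-nullity concludes. *)
Lemma generalized_jacobian_eq0_kernel t : generalized_jacobian f t = 0 ->
  ((D - d).+1 <= \rank (kermx (jacobian f t)))%N.
Proof.
rewrite /generalized_jacobian => /eqP; rewrite sqrtr_eq0 => /det_gram_le0[v v0 vA].
have : (\rank (derivative_mx f t) < d)%N.
  rewrite ltn_neqAle rank_leq_row andbT; apply: contraNN v0 => rd.
  by rewrite -(mulmx_free_eq0 v rd) vA.
rewrite /derivative_mx mxrank_tr mxrank_ker; move: (\rank _) => r; lia.
Qed.

Lemma open_preimage_ball u r : open [set t | T t /\ ball u r (f t)].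
Proof.
rewrite openE => t [Tt ut]; rewrite /interior; near=> s.
split; near: s; first exact: open_nbhs_nbhs.
have /differentiable_continuous cf := (fC1 Tt).1.
by apply: cf; apply: open_nbhs_nbhs; split => //; exact: ball_open.
Unshelve. all: by end_near. Qed.

Variables (u : 'rV[R]_d) (K : set 'rV[R]_D) (eta : R).
Hypotheses (K_compact : compact K) (eta_gt0 : 0 < eta).
Hypothesis K_eta : forall t, K t -> ball t eta `<=` T.

Let Z := [set t | K t /\ [/\ T t, f t = u & generalized_jacobian f t = 0]].

(* Along the kernel of the Jacobian, of dimension at least [D - d + 1], the
   map [f] varies by [o(rho)] at distance [O(rho)], so that the set where [f] is
   [L rho]-close to [u] contains about [N ^ (D - d + 1)] disjoint balls of
   radius [rho / 2] close to each point of [Z]. *)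
Lemma kernel_balls : exists2 L : R, 0 < L & forall N, exists2 rho0 : R, 0 < rho0 &
  forall rho m (c : 'I_m -> 'rV[R]_D), 0 < rho < rho0 -> (forall i, Z (c i)) ->
  (forall i j, i != j -> rho * (2 * ((D - d).+1 * N) + 1)%:R <= `|c i - c j|) ->
  ((m%:R * N%:R ^+ (D - d).+1 * rho ^+ D)%:E <=
    lebesgue_rV R D [set t | T t /\ ball u (L * rho) (f t)])%E.
Proof.
have KT : K `<=` T by move=> t Kt; apply: (K_eta Kt); exact: ballxx.
have [L0 L00 JL] := jacobian_bound fC1 K_compact KT.
set k := (D - d).+1.
pose L := D.+1%:R * L0; have L_gt0 : 0 < L by rewrite mulr_gt0.
(* All the small balls lie within [rho * M] of their point [c i]. The tolerance [L / (4 * M)] then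
   keeps the Taylor remainder below [L * rho / 4]. *)
exists L => // N; pose M : R := (k * N)%:R + 1; have M0 : 0 < M by rewrite ltr_wpDl.
have [|r1 r10 fdiff] := @unif_diff _ _ _ _ _ fC1 K (L / (4 * M)) T_open K_compact KT.
  by rewrite divr_gt0// mulr_gt0.
(* [rho * M] must be below [r1] for the Taylor estimate and below [eta] to stay in [T]. *)
exists (Num.min r1 eta / M).
  by rewrite divr_gt0// lt_min r10.
move=> rho m c /andP[rho0]; rewrite ltr_pdivlMr// lt_min => /andP[rhor1 rhoeta] Zc sep.
have /choice[w wP] t : exists w : 'I_(N ^ k) -> 'rV[R]_D, Z t ->
    [/\ (forall a, w a *m jacobian f t = 0), (forall a, `|w a| <= (k * N)%:R) &
    forall a b, a != b -> 1 <= `|w a - w b|].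
  have [[_ [_ _ /generalized_jacobian_eq0_kernel kr]]|nZ] := pselect (Z t);
    last by exists (fun=> 0).
  have [I [w [cI wker wN wsep]]] := sep_lattice_in_subspace N kr.
  exists (fun a => w (enum_val (cast_ord (esym cI) a))) => _; split=> [a|//|a b ab].
    exact/sub_kermxP.
  by apply: wsep; rewrite (inj_eq enum_val_inj) (inj_eq (@cast_ord_inj _ _ _)).
have := @sep_balls_volume _ D ('I_m * 'I_(N ^ k))%type
  (fun ia => c ia.1 + rho *: w (c ia.1) ia.2) rho
  [set t | T t /\ ball u (L * rho) (f t)] rho0.
rewrite card_prod !card_ord natrM natrX; apply.
- by apply: open_measurable_mx; exact: open_preimage_ball.
- move=> [i a] [j b] /=.
  have [wi wiN wsep] := wP _ (Zc i); have [_ wjN _] := wP _ (Zc j).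
  have [Eij|ij _] := eqVneq i j; [subst j|].
    rewrite xpair_eqE eqxx /= => ab; rewrite opprD addrACA subrr add0r -scalerBr.
    rewrite normrZ gtr0_norm//; by apply: ler_peMr; [exact: ltW|exact: wsep].
  (* Two displacements of at most [rho * (k * N)] are subtracted from the separation
     [rho * (2 * (k * N) + 1)], which leaves [rho]. *)
  have /sep := ij; set x := c i - c j => hx.
  rewrite opprD addrACA -/x.
  apply: le_trans (lerB_normD _ _).
  rewrite lerBrDr; apply: le_trans hx; rewrite -scalerBr normrZ gtr0_norm//.
  rewrite natrD natrM mulrDr mulr1 addrC lerD2r; apply: ler_wpM2l; first exact: ltW.
  by rewrite mulr_natl mulr2n; apply: le_trans (ler_normB _ _) _; exact: lerD.
move=> [i a] y /=; have [wi wiN _] := wP _ (Zc i); have [Ki [_ fi _]] := Zc i.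
rewrite -ball_normE /= distrC => yi; set h := y - c i.
(* The second term lies in the kernel of the Jacobian; only the first, of norm below [rho / 2],
   contributes to the linear part. *)
have hE : h = (y - (c i + rho *: w (c i) a)) + rho *: w (c i) a.
  by rewrite /h opprD addrA subrK.
have hM : `|h| <= rho * M.
  rewrite hE; apply: le_trans (ler_normD _ _) _; rewrite addrC /M mulrDr mulr1 lerD//.
    by rewrite normrZ gtr0_norm// ler_wpM2l// ltW.
  by rewrite (le_trans (ltW yi))// ler_pdivrMr// ler_pMr// ler1n.
have yE : y = c i + h by rewrite /h addrC subrK.
split.
  by apply: (K_eta Ki); rewrite -ball_normE /= distrC (le_lt_trans hM).
have := fdiff _ h Ki (le_lt_trans hM rhor1); rewrite -yE fi => hf.
have hJ : `|h *m jacobian f (c i)| <= L * rho / 2.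
  rewrite hE mulmxDl -scalemxAl wi scaler0 addr0.
  apply: le_trans (norm_mulmx _ _) _.
  have -> : L * rho / 2 = D.+1%:R * (rho / 2) * L0 by rewrite /L; ring.
  rewrite ler_pM ?mulr_ge0//; last exact: JL.
  by rewrite ler_pM ?ler_nat// ltW.
rewrite -ball_normE /= distrC -[f y - u](subrK (h *m jacobian f (c i))).
apply: le_lt_trans (ler_normD _ _) _.
apply: (@le_lt_trans _ _ (L / (4 * M) * (rho * M) + L * rho / 2)).
  apply: lerD => //; apply: le_trans hf _.
  by rewrite ler_wpM2l// divr_ge0 ?ltW// mulr_gt0.
have -> : L / (4 * M) * (rho * M) = L * rho / 4 by field; rewrite gt_eqF.
have : 0 < L * rho by rewrite mulr_gt0.
lra.
Qed.

Hypothesis lower_density : exists2 B : R, 0 <= B & forall r0, 0 < r0 ->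
  exists2 r, 0 < r < r0 &
    (lebesgue_rV R D [set t | T t /\ ball u r (f t)] <= (B * r ^+ d)%:E)%E.

(** With [r = L * rho] and [l = D - d], [kernel_balls] bounds [m * N ^ l.+1 * rho ^ l] by
    [B * L ^ d] for separated families. The covering balls of radius [rho * M], with [M] of order
    [N], have gauge sum at most [cst / N]. *)
Lemma hausdorff_critical_compact : hausdorff_measure (D - d) Z = 0%E.
Proof.
have [B B0 HB] := lower_density.
apply/hausdorff_measure_eq0P => delta e delta0 e0.
have [L L0 kb] := kernel_balls.
set l := (D - d)%N; set w := unit_ball_volume l : R.
have w0 : 0 <= w by exact: unit_ball_volume_ge0.
pose cst := w * (3 * l.+1%:R * D%:R) ^+ l * (B * L ^+ d).
have c30 : 0 <= 3 * l.+1%:R * D%:R :> R by rewrite !mulr_ge0.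
have cst0 : 0 <= cst.
  have Ld : 0 <= L ^+ d by rewrite exprn_ge0// ltW.
  by apply: mulr_ge0; apply: mulr_ge0 => //; exact: exprn_ge0.
pose N := (Num.bound (cst / e)).+1.
have N0 : 0 < N%:R :> R by rewrite ltr0n.
have cstN : cst <= e * N%:R.
  rewrite -ler_pdivrMl// mulrC ltW//; apply: (lt_trans (archi_boundP _)).
    by rewrite divr_ge0// ltW.
  by rewrite ltr_nat.
have [rho0 rho00 {}kb] := kb N.
pose M : R := (2 * (l.+1 * N) + 1)%:R; have M0 : 0 < M by rewrite ltr0n addn1.
(* The second bound keeps the diameters of the covering balls below [delta]. *)
pose rho1 := Num.min rho0 (delta / (2 * D.+1%:R * M)).
have rho10 : 0 < rho1 by rewrite lt_min rho00 divr_gt0// ?mulr_gt0.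
have [r /andP[r0 rlt] Hr] := HB (L * rho1) (mulr_gt0 L0 rho10).
have [rho [rhogt0 rE rhorho1]] : exists rho, [/\ 0 < rho, L * rho = r & rho < rho1].
  exists (r / L); split; first by rewrite divr_gt0.
    by rewrite mulrC divfK// gt_eqF.
  by rewrite ltr_pdivrMr// mulrC.
have key m (c : 'I_m -> 'rV[R]_D) : (forall i, Z (c i)) ->
    (forall i j, i != j -> rho * M <= `|c i - c j|) ->
    m%:R * N%:R ^+ l.+1 * rho ^+ D <= B * r ^+ d.
  move=> Zc sc; rewrite -lee_fin; apply: le_trans Hr; rewrite -rE; apply: kb Zc sc.
  by rewrite rhogt0 (lt_le_trans rhorho1)// ge_min lexx.
have Nrho0 : 0 < N%:R ^+ l.+1 * rho ^+ D by rewrite mulr_gt0// exprn_gt0.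
have [|m [c [Zc sc Zcover]]] := @maximal_separated _ Z (rho * M)
    (Num.bound (B * r ^+ d / (N%:R ^+ l.+1 * rho ^+ D))).
  move=> m c Zc sc; rewrite -(ler_nat R).
  apply: le_trans (ltW (archi_boundP _)); last first.
    apply: divr_ge0; last exact: ltW.
    by rewrite mulr_ge0// exprn_ge0// ltW.
  by rewrite ler_pdivlMr// mulrA; exact: key Zc sc.
have [||F [ZF dF Fe]] := @ball_cover_gauge_sum _ _ l Z m c (rho * M) delta _ Zcover.
- by rewrite mulr_gt0.
- have : rho <= delta / (2 * D.+1%:R * M).
    by rewrite (le_trans (ltW rhorho1))// ge_min lexx orbT.
  rewrite ler_pdivlMr ?mulr_gt0//; apply: le_trans.
  have -> : rho * (2 * D.+1%:R * M) = D.+1%:R * (rho * M *+ 2) by ring.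
  by rewrite ler_wpM2r ?ler_nat// mulrn_wge0// mulr_ge0// ltW.
exists F; split => //; apply: le_trans Fe _; rewrite lee_fin -/w.
rewrite -(ler_pM2r N0); apply: le_trans cstN.
have {}key : m%:R * N%:R ^+ l.+1 * rho ^+ l <= B * L ^+ d.
  have rhod : 0 < rho ^+ d by rewrite exprn_gt0.
  have -> : B * L ^+ d = B * r ^+ d / rho ^+ d.
    by rewrite -rE exprMn mulrA mulfK// gt_eqF.
  rewrite ler_pdivlMr// -[leLHS]mulrA -exprD subnK//.
  exact: key Zc sc.
(* As [N >= 1], [M = 2 * (l.+1 * N) + 1] is at most [3 * l.+1 * N]. *)
have sM : (D%:R * (rho * M)) ^+ l <= (3 * l.+1%:R * D%:R) ^+ l * (rho ^+ l * N%:R ^+ l).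
  have rho_ge0 := ltW rhogt0; have M_ge0 := ltW M0.
  rewrite -!exprMn; apply: lerXn2r; rewrite ?nnegrE ?mulr_ge0//.
  have -> : 3 * l.+1%:R * D%:R * (rho * N%:R) = D%:R * (rho * (3 * l.+1 * N)%:R).
    by rewrite !natrM; ring.
  rewrite ler_wpM2l// ler_wpM2l// ler_nat; clear; nia.
apply: (@le_trans _ _ (w * (3 * l.+1%:R * D%:R) ^+ l *
    (m%:R * N%:R ^+ l.+1 * rho ^+ l))).
  have -> : w * (3 * l.+1%:R * D%:R) ^+ l * (m%:R * N%:R ^+ l.+1 * rho ^+ l) =
    m%:R * (w * ((3 * l.+1%:R * D%:R) ^+ l * (rho ^+ l * N%:R ^+ l))) * N%:R.
    by rewrite [N%:R ^+ l.+1]exprSr; ring.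
  by rewrite ler_wpM2r// ler_wpM2l// ler_wpM2l.
by rewrite ler_wpM2l// mulr_ge0// exprn_ge0// !mulr_ge0.
Qed.

End critical_level_set.

(** * Random fields *)

Section random_field.
Context {R : realType}.

Lemma nbhs_rat_mx m n (t : 'M[R]_(m, n)) (U : set 'M[R]_(m, n)) : nbhs t U ->
  exists q : 'M[rat]_(m, n), U (map_mx ratr q).
Proof.
move=> tU; have : U^° t by [].
rewrite (open_mx_bigcup (@open_interior _ U)) => -[[q k] _] /=.
case: ifPn => // /asboolP qU _; exists q; apply: (@interior_subset _ U).
by apply: qU; apply: ballxx; rewrite invr_gt0.
Qed.

Lemma hausdorff_critical_level (D d : nat) (T : set 'rV[R]_D)
    (f : 'rV[R]_D -> 'rV[R]_d) (u : 'rV[R]_d) :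
  (d <= D)%N -> open T -> class_C1 T f ->
  (exists2 B : R, 0 <= B & forall r0, 0 < r0 -> exists2 r, 0 < r < r0 &
    (lebesgue_rV R D [set t | T t /\ ball u r (f t)] <= (B * r ^+ d)%:E)%E) ->
  hausdorff_measure (D - d)
    [set t | [/\ T t, f t = u & generalized_jacobian f t = 0]] = 0%E.
Proof.
move=> D_ged oT fC1 HB.
(* A compact exhaustion of [T]: bounded points at distance at least [1 / j.+1] from the complement
   of [T]. *)
pose K j := [set t | `|t| <= j%:R] `&` ~` \bigcup_(y in ~` T) ball y (j.+1%:R^-1 : R).
apply: (@hausdorff_measure_bigcup_eq0 _ _ _ _ (fun j => [set t | K j t /\
    [/\ T t, f t = u & generalized_jacobian f t = 0]])) => [t Zt|j].
  have [Tt _ _] := Zt.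
  have /nbhs_ballP[e /= e0 eT] : nbhs t T by exact: open_nbhs_nbhs.
  pose j := Num.bound (Num.max `|t| e^-1); exists j => //; split=> //.
  have max0 : 0 <= Num.max `|t| e^-1 by rewrite le_max normr_ge0.
  have := archi_boundP max0; rewrite -/j gt_max => /andP[tj ej].
  split; first exact: ltW.
  move=> [y nTy yt]; apply: nTy; apply: eT; apply: ball_sym.
  apply: le_ball yt; rewrite -[leRHS]invrK lef_pV2 ?posrE ?invr_gt0//.
  by rewrite (le_trans (ltW ej))// ler_nat.
apply: (@hausdorff_critical_compact _ _ _ _ _ D_ged oT fC1 u (K j) j.+1%:R^-1) => //.
- apply: bounded_closed_compact.
    exists j%:R; split => // M jM t [/= tj _]; exact: le_trans tj (ltW jM).
  apply: closedI; last first.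
    by apply: open_closedC; apply: bigcup_open => y _; exact: ball_open.
  rewrite (_ : [set t | _] = closed_ball_ Num.norm 0 j%:R).
    exact: closed_closed_ball_.
  by apply/seteqP; split => t; rewrite /closed_ball_ /= sub0r normrN.
- move=> t [_ nt] y ty; apply: contrapT => nTy; apply: nt; exists y => //.
  exact: ball_sym.
Qed.

Variables (D d : nat) (dO : measure_display) (Omega : measurableType dO).
Variables (T : set 'rV[R]_D) (X : 'rV[R]_D -> Omega -> 'rV[R]_d).
Hypotheses (T_open : open T)
  (X_random : forall t, T t -> measurable_fun setT (X t))
  (X_C1 : forall w, class_C1 T (fun t => X t w)).

Let near_level u r : set ('rV[R]_D * Omega) :=
  [set tw | T tw.1 /\ ball u r (X tw.1 tw.2)].

(* By continuity of the paths, [near_level u r] is a countable union of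
   measurable rectangles, indexed by rational balls and radii [< r]. *)
Lemma measurable_near_level u r : measurable (near_level u r).
Proof.
pose B (z : 'M[rat]_(1, D) * nat) := ball (map_mx ratr z.1 : 'rV[R]_D) z.2.+1%:R^-1.
(* Avoiding [far] at every rational [q] in the ball keeps the whole path over that ball within
   [r - 1 / m.+1] of [u], by continuity. The test on [q] ensures [T q], hence measurability, when
   the ball lies in [T]. *)
pose far (z : 'M[rat]_(1, D) * nat) m (q : 'M[rat]_(1, D)) : set Omega :=
  if `[< B z (map_mx ratr q) >] then
    X (map_mx ratr q) @^-1` [set v | r - m.+1%:R^-1 < `|u - v|] else set0.
have -> : near_level u r = \bigcup_(zm : ('M[rat]_(1, D) * nat) * nat)
    (if `[< B zm.1 `<=` T >] then
      B zm.1 `*` ~` \bigcup_q far zm.1 zm.2 q else set0).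
  apply/seteqP; split => [[t w] [/= Tt]|[t w] [[z m] _] /=].
    rewrite -ball_normE /= => tr.
    have [m rm] : exists m : nat, `|u - X t w| < r - m.+1%:R^-1.
      have rt : 0 < r - `|u - X t w| by rewrite subr_gt0.
      have [k _ kP] := near_infty_natSinv_lt (PosNum rt).
      by exists k; have := kP k (leqnn _); rewrite /= ltrBrDr addrC -ltrBrDr.
    have : [set s | T s /\ ball u (r - m.+1%:R^-1) (X s w)] t.
      by split => //; rewrite -ball_normE.
    rewrite (open_mx_bigcup (@open_preimage_ball _ _ _ _ _
      T_open (X_C1 w) u (r - m.+1%:R^-1))).
    move=> [z _]; case: ifPn => // /asboolP zU zt.
    exists (z, m) => //=; rewrite ifT; last by apply/asboolP => s /zU[].
    split => // -[q _]; rewrite /far; case: ifPn => // /asboolP zq /=.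
    by have [_] := zU _ zq; rewrite -ball_normE /= => /ltW; rewrite leNgt => /negP.
  case: ifPn => // /asboolP zT [/= zt nfar]; have Tt := zT _ zt; split => //.
  rewrite -ball_normE /=; apply: (@le_lt_trans _ _ (r - m.+1%:R^-1)); last first.
    by rewrite ltrBlDr ltrDl invr_gt0.
  rewrite leNgt; apply/negP => rt; apply: nfar.
  have /differentiable_continuous Xc := (X_C1 w Tt).1.
  have : \forall s \near t, r - m.+1%:R^-1 < `|u - X s w| /\ B z s.
    have cn : `|u - X s w| @[s --> t] --> `|u - X t w|.
      exact: (cvg_norm (cvgB (@cvg_cst _ u _ _ _) Xc)).
    near=> s; split; near: s; first exact: cvgr_gt cn _ rt.
    by apply: open_nbhs_nbhs; split => //; exact: ball_open.
  move=> /nbhs_rat_mx[q [rq zq]]; exists q => //.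
  by rewrite /far ifT//; apply/asboolP.
apply: countable_bigcupT_measurable; first exact: countableP.
move=> [z m] /=; case: ifPn => // /asboolP zT.
apply: measurableX; first exact: measurable_ball_rV.
apply: measurableC; apply: countable_bigcupT_measurable; first exact: countableP.
move=> q; rewrite /far; case: ifPn => // /asboolP zq.
rewrite -[X in measurable X]setTI; apply: X_random => //; first exact: zT.
apply: open_measurable_mx.
rewrite (_ : [set v | _] = (fun v => `|u - v|) @^-1` [set y | r - m.+1%:R^-1 < y])//.
apply: open_comp; last exact: open_gt.
move=> v _; exact: (cvg_norm (cvgB (@cvg_cst _ u _ _ _) (@cvg_id _ (nbhs v)))).
Unshelve. all: by end_near. Qed.

Variable P : probability Omega R.
Variables (u : 'rV[R]_d) (p : 'rV[R]_D -> 'rV[R]_d -> R) (C : R) (V : set 'rV[R]_d).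
Hypotheses (p_measurable : measurable_fun (T `*` setT)
      (fun tv : 'rV[R]_D * 'rV[R]_d => p tv.1 tv.2))
    (p_density : forall t, T t -> has_density P (X t) (p t))
    (p_bound : forall v, V v ->
      (\int[lebesgue_rV R D]_(t in T) (p t v)%:E < C%:E)%E).

Lemma ysection_near_level r w :
  ysection (near_level u r) w = [set t | T t /\ ball u r (X t w)].
Proof. by apply/seteqP; split => t; rewrite /ysection /= inE. Qed.

(** By Tonelli the left side is the integral over [T] of the probability that [X t] is in the ball,
    that is, of [p] over [T] times the ball. Integrating in [t] first gives at most [C] times the
    volume of the ball. *)
Lemma expected_near_level_volume r : 0 < r -> ball u r `<=` V ->
  (\int[P]_w lebesgue_rV R D [set t | T t /\ ball u r (X t w)] <=
    (C * (2 * r) ^+ d)%:E)%E.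
Proof.
move=> r0 urV.
have mA := measurable_near_level u r; set A := near_level u r in mA.
pose B : set 'rV[R]_d := ball u r.
have mB : measurable B by exact: measurable_ball_rV.
have mT : measurable T by exact: open_measurable_mx.
(* Extension by 0 allows Tonelli on the whole product space. *)
pose g := (fun tv : 'rV[R]_D * 'rV[R]_d => (p tv.1 tv.2)%:E) \_ (T `*` B).
have mg : measurable_fun setT g.
  apply/(measurable_restrictT _ (measurableX mT mB)).
  have mp : measurable_fun (T `*` setT)
      (EFin \o (fun tv : 'rV[R]_D * 'rV[R]_d => p tv.1 tv.2)).
    exact/measurable_EFinP.
  apply: measurable_funS mp; first exact: (measurableX mT measurableT).
  by move=> [t v] /= [].
have gE t v : g (t, v) = if (t \in T) && (v \in B) then (p t v)%:E else 0%E.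
  by rewrite /g patchE in_setX.
have g0 z : (0 <= g z)%E.
  case: z => t v; rewrite gE; case: ifPn => // /andP[/set_mem Tt _].
  by rewrite lee_fin; have [_ + _] := p_density Tt; exact.
rewrite [leLHS](_ : _ =
    \int[lebesgue_rV R D]_t \int[lebesgue_rV R d]_v g (t, v))%E; last first.
  under eq_integral do rewrite -ysection_near_level.
  have := indic_fubini_tonelli (lebesgue_rV R D) P mA.
  rewrite indic_fubini_tonelli_FE// indic_fubini_tonelli_GE// => /esym ->.
  apply: eq_integral => t _ /=.
  have [tT|tT] := boolP (t \in T); last first.
    rewrite (_ : xsection A t = set0); last first.
      apply/seteqP; split => w //; rewrite /xsection /= inE => -[/= /mem_set].
      by rewrite (negPf tT).
    by rewrite measure0 integral0_eq// => v _; rewrite gE (negPf tT).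
  have Tt := set_mem tT; have [_ _ /(_ _ mB) pB] := p_density Tt.
  rewrite (_ : xsection A t = X t @^-1` B); last first.
    apply/seteqP; split => w; rewrite /xsection /= inE; first by case.
    by move=> ?; split.
  rewrite [LHS]pB integral_mkcond; apply: eq_integral => v _.
  by rewrite gE tT patchE.
rewrite fubini_tonelli//.
apply: (@le_trans _ _ (\int[lebesgue_rV R d]_v ((cst C%:E) \_ B) v)%E).
  apply: ge0_le_integral => //.
  - by move=> v _; apply: integral_ge0 => t _.
  - exact: (measurable_fun_fubini_tonelli_G _ mg).
  - by apply/(measurable_restrictT _ mB); exact: measurable_cst.
  - move=> v _; rewrite patchE; case: ifPn => vB; last first.
      by rewrite integral0_eq// => t _; rewrite gE (negPf vB) andbF.
    apply/ltW; apply: le_lt_trans (p_bound (urV _ (set_mem vB))).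
    rewrite [leRHS]integral_mkcond le_eqVlt; apply/orP; left; apply/eqP.
    by apply: eq_integral => t _; rewrite gE vB andbT patchE.
rewrite -integral_mkcond integral_cst// [X in (_ * X)%E](_ : _ = ((2 * r) ^+ d)%:E)//.
exact: lebesgue_rV_ball.
Qed.

(** Fatou's lemma along the radii [e / n.+1] makes the lower limit of the volumes divided by
    [r n ^+ d] integrable, hence almost surely finite. *)
Lemma ae_lower_density : nbhs u V -> {ae P, forall w,
  exists2 B : R, 0 <= B & forall r0, 0 < r0 -> exists2 r, 0 < r < r0 &
    (lebesgue_rV R D [set t | T t /\ ball u r (X t w)] <= (B * r ^+ d)%:E)%E}.
Proof.
move=> /nbhs_ballP[e /= e0 eV]; pose r n : R := e / n.+1%:R.
have r_gt0 n : 0 < r n by rewrite divr_gt0.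
have r_le n : r n <= e.
  rewrite ler_pdivrMr//; apply: ler_peMr; [exact: ltW|by rewrite ler1n].
pose vol n w := lebesgue_rV R D [set t | T t /\ ball u (r n) (X t w)].
pose h n w := ((r n ^- d)%:E * vol n w)%E.
have rd_ge0 n : 0 <= r n ^- d by rewrite invr_ge0 exprn_ge0// ltW.
have mvol n : measurable_fun setT (vol n).
  rewrite (_ : vol n = lebesgue_rV R D \o ysection (near_level u (r n))).
    by apply: measurable_fun_ysection; exact: measurable_near_level.
  by apply/funext => w /=; rewrite ysection_near_level.
have h_ge0 n w : (0 <= h n w)%E by rewrite mule_ge0 ?lee_fin.
have mh n : measurable_fun setT (h n) by apply: measurable_funeM.
have int_h n : (\int[P]_w h n w <= (C * 2 ^+ d)%:E)%E.
  have k0 : (0 <= (r n ^- d)%:E)%E by rewrite lee_fin.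
  rewrite ge0_integralZl//.
  have := expected_near_level_volume (r_gt0 n) (subset_trans (le_ball (r_le n)) eV).
  move=> /(lee_wpmul2l k0)/le_trans; apply.
  have : r n ^+ d != 0 by rewrite expf_neq0// gt_eqF.
  rewrite -EFinM lee_fin (exprMn_comm d (mulrC 2 (r n))); move: (r n ^+ d) => y y0.
  rewrite (_ : y^-1 * (C * (2 ^+ d * y)) = C * 2 ^+ d)//; by field.
pose g w := limn_einf (h ^~ w).
have gE w : g w = ereal_sup (range (einfs (h ^~ w))).
  by rewrite /g limn_einf_lim; apply/cvg_lim => //; exact: cvg_einfs_sup.
have g_ge0 w : (0 <= g w)%E.
  rewrite gE; apply: le_trans (ereal_sup_ubound _); last by exists 0%N.
  by apply: le_ereal_inf_tmp => _ [n _ <-].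
have mg : measurable_fun setT g.
  rewrite /g; under eq_fun do rewrite /limn_einf.
  apply: measurableT_comp; first exact: oppe_measurable.
  by apply: measurable_fun_limn_esup => n; exact: measurableT_comp.
have int_g : (\int[P]_w g w <= (C * 2 ^+ d)%:E)%E.
  apply: le_trans (fatou _ _ _ _) _ => //.
  rewrite limn_einf_lim; apply: lime_le; first exact: is_cvg_einfs.
  apply: nearW => k; apply: le_trans (int_h k).
  by apply: ereal_inf_lbound; exists k => //=.
have : P.-integrable setT g.
  apply/integrableP; split => //.
  under eq_integral do rewrite gee0_abs//.
  exact: le_lt_trans int_g (ltry _).
move=> /(integrable_ae measurableT); apply: filterS => w /(_ I) gfin.
have [B gB] : exists B, g w = B%:E by exists (fine (g w)); rewrite fineK.
have B0 : 0 <= B by rewrite -lee_fin -gB.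
(* Each tail infimum is at most [B], so strictly below [B + 1], and some index of the tail realizes
   this bound. The tail starts at [k > e / r0], which gives [r n < r0]. *)
exists (B + 1); first by rewrite addr_ge0.
move=> r0 r00; pose k := Num.bound (e / r0).
have : (einfs (h ^~ w) k < (B + 1)%:E)%E.
  apply: (@le_lt_trans _ _ (g w)); last by rewrite gB lte_fin ltrDl.
  by rewrite gE; apply: ereal_sup_ubound; exists k.
move=> /ereal_inf_lt[_ [n /= kn <-] hB]; exists (r n).
  rewrite r_gt0 /r ltr_pdivrMr// mulrC -ltr_pdivrMr//.
  apply: (lt_trans (archi_boundP _)); first by rewrite divr_ge0// ltW.
  by rewrite ltr_nat ltnS.
move: hB; rewrite /h -/(vol n w); move: (vol n w) => x /ltW.
have rd0 : 0 < r n ^+ d by rewrite exprn_gt0.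
rewrite muleC lee_pdivrMr//.
Qed.

End random_field.

Theorem proposition2p2 (R : realType) (D d : nat)
    (d_ge1 : (1 <= d)%N) (D_ged : (d <= D)%N)
    (dO : measure_display) (Omega : measurableType dO) (P : probability Omega R)
    (T : set 'rV[R]_D) (T_open : open T)
    (X : 'rV[R]_D -> Omega -> 'rV[R]_d)
    (X_random : forall t, T t -> measurable_fun setT (X t))
    (X_C1 : forall w, class_C1 T (fun t => X t w))
    (u : 'rV[R]_d)
    (p : 'rV[R]_D -> 'rV[R]_d -> R)
    (p_measurable : measurable_fun (T `*` setT)
      (fun tv : 'rV[R]_D * 'rV[R]_d => p tv.1 tv.2))
    (p_density : forall t, T t -> has_density P (X t) (p t))
    (C : R) (V : set 'rV[R]_d) (V_nbhs : nbhs u V)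
    (p_bound : forall v, V v ->
      (\int[lebesgue_rV R D]_(t in T) (p t v)%:E < C%:E)%E) :
  {ae P, forall w, hausdorff_measure (D - d)
    [set t | [/\ T t, X t w = u &
                 generalized_jacobian (fun s => X s w) t = 0]] = 0%E}.
Proof.
have := ae_lower_density T_open X_random X_C1 p_measurable p_density p_bound V_nbhs.
by apply: filterS => w; exact: hausdorff_critical_level.
Qed.
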